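(* Let $k\in\mathbb{N}$, let $P$ be the uniform distribution on $[0,1]$, and let $\beta=\{\frac jk:1\leq j\leq k\}$. For $1\le j\le k$ let $J_{k,j}=[\frac{j-1}k,\frac jk]$. Let $n\geq k$ and let $\alpha_n$ be a conditional optimal set of $n$-points for $P$ with respect to $\beta$, where $n=mk+\ell$ with $m\in\mathbb{N}$ and $\ell$ an integer with $0\leq\ell<k$. Then: (i) if $\ell=0$, then $\mathrm{card}(\alpha_n\cap J_{k,1})=m$ and $\mathrm{card}(\alpha_n\cap J_{k,j})=m+1$ for $2\leq j\leq k$; (ii) if $1\leq\ell<k$, then $\mathrm{card}(\alpha_n\cap J_{k,1})=m+1$, $\mathrm{card}(\alpha_n\cap J_{k,j})=m+2$ for $j\in\{j_1,\dots,j_{\ell-1}\}$, and $\mathrm{card}(\alpha_n\cap J_{k,j})=m+1$ for $j\in\{2,\dots,k\}\setminus\{j_1,\dots,j_{\ell-1}\}$, where $\{j_1,\dots,j_{\ell-1}\}$ is some subset of $\ell-1$ elements of $\{2,3,\dots,k\}$.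
   Context: Conditional quantization on $\mathbb{R}$: for a Borel probability measure $P$ on $\mathbb{R}$ and a finite set $\beta\subset\mathbb{R}$ with $\mathrm{card}(\beta)=r$, for $n\geq r$ the $n$th conditional quantization error is $V_n=\inf\{\int\min_{a\in\alpha\cup\beta}(x-a)^2\,dP(x):\alpha\subset\mathbb{R},\ \mathrm{card}(\alpha)\leq n-r\}$. A set $\alpha\cup\beta$ attaining this infimum, such that each $b\in\beta$ has a Voronoi region (set of points at least as close to $b$ as to any other point of $\alpha\cup\beta$) of positive $P$-measure, is a conditional optimal set of $n$-points for $P$ with respect to $\beta$; it contains $\beta$. *)

(* Defs.v *)
From HB Require Import structures.
From mathcomp Require Import all_boot all_order all_algebra finmap.
From mathcomp Require Import all_classical all_reals all_analysis.
Set Implicit Arguments. Unset Strict Implicit. Unset Printing Implicit Defensive.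
Import Order.TTheory GRing.Theory Num.Theory.
Local Open Scope classical_set_scope.
Local Open Scope ring_scope.
Local Open Scope fset_scope.

Section CondQuant.
Variable R : realType.

Definition mindist (S : {fset R}) (x : R) : \bar R :=
  \big[Order.min/+oo%E]_(a <- S) ((x - a) ^+ 2)%:E.

Definition qerr (P : probability (g_sigma_algebraType R.-ocitv.-measurable) R) (S : {fset R}) : \bar R :=
  (\int[P]_x mindist S x)%E.

Definition cond_qerr (P : probability (g_sigma_algebraType R.-ocitv.-measurable) R) (beta : {fset R}) (n : nat) : \bar R :=
  ereal_inf [set qerr P (alpha `|` beta) |
             alpha in [set alpha : {fset R} | (#|` alpha| <= n - #|` beta|)%N]].

Definition voronoi (S : {fset R}) (b : R) : set R :=
  [set x | forall a, a \in S -> `|x - b| <= `|x - a|].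

Definition cond_optimal (P : probability (g_sigma_algebraType R.-ocitv.-measurable) R) (beta : {fset R}) (n : nat)
    (gamma : {fset R}) : Prop :=
  exists alpha : {fset R},
    [/\ (#|` alpha| <= n - #|` beta|)%N, gamma = alpha `|` beta,
        qerr P gamma = cond_qerr P beta n &
        forall b, b \in beta -> (0 < P (voronoi gamma b))%E].

End CondQuant.

Definition unif01 (R : realType) : probability (g_sigma_algebraType R.-ocitv.-measurable) R :=
  uniform_prob (@ltr01 R).

Definition beta_k (R : realType) (k : nat) : {fset R} :=
  [fset (j%:R / k%:R : R) | j in iota 1 k].

Definition cardJ (R : realType) (k j : nat) (gamma : {fset R}) : nat :=
  #|` [fset x in gamma | ((j.-1)%:R / k%:R <= x <= j%:R / k%:R)%R] |.

(* Main.v *)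
Require Import Defs.
From HB Require Import structures.
From mathcomp Require Import all_boot all_order all_algebra finmap.
From mathcomp Require Import all_classical all_reals all_analysis.
From mathcomp Require Import measurable_realfun.
From mathcomp Require Import ring lra zify.
Import Order.TTheory GRing.Theory Num.Theory.
Import numFieldTopology.Exports numFieldNormedType.Exports.

(** The grid cuts [0,1] into [k] cells of length [h = 1/k]. In a cell with [c]
    inner points the error is at least [h^3 / (3 p^2)], where [p = 2 c + 2], or
    [p = 2 c + 1] in the first cell, whose left end is free; equidistant points
    attain this. The lower bound needs no sorting of the points: with
    [w = h / p], integrate the pointwise inequality
    [w^2 <= min_s (x - s)^2 + sum_s max(0, w^2 - (x - s)^2)],
    in which each inner point contributes at most [4 w^3 / 3] to the sum and
    each end of the cell half of that. Hence an optimal set minimizes the sum of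
    [1 / p_j^2] over all distributions of [n - k] points. Since
    [1 / p^2 - 1 / (p + 2)^2] decreases strictly in [p], moving one point between
    cells shows [p_i <= p_j + 2] for all [i] and [j], and the counts follow. *)

Section Quantization.
Local Open Scope classical_set_scope.
Local Open Scope ring_scope.
Local Set Implicit Arguments.
Local Unset Strict Implicit.

(** * Integrals of quadratics and truncated parabolas over segments *)

Section SegmentIntegral.
Variable R : realType.
Local Notation mu := (@lebesgue_measure R).
Implicit Types (a b c s w : R) (f : R -> \bar R).

Lemma measurable_quadratic (d e s : R) (D : set R) :
  measurable_fun D (fun x : R => (d + e * (x - s) ^+ 2)%:E).
Proof.
apply/measurable_EFinP/measurable_funD => //; apply: measurable_funM => //.
by apply: measurable_funX; exact: measurable_funB.
Qed.

Lemma integral_quadratic (d e s a b : R) : a <= b ->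
  (\int[mu]_(x in `[a, b]) (d + e * (x - s) ^+ 2)%:E
   = (d * (b - a) + e * (((b - s) ^+ 3 - (a - s) ^+ 3) / 3))%:E)%E.
Proof.
rewrite le_eqVlt => /predU1P[<-|ab].
  by rewrite set_itv1 integral_set1; congr EFin; ring.
pose F x : R := d * x + e * ((x - s) ^+ 3 / 3).
have dF (x : R) : is_derive x (1:R) F (d + e * (x - s) ^+ 2).
  by apply: is_derive_eq; rewrite /GRing.scale /=; field.
have cF (x : R) : {for x, continuous F}.
  by apply/differentiable_continuous/derivable1_diffP.
rewrite (@continuous_FTC2 _ _ F)//.
- by rewrite -EFinB; congr EFin; rewrite /F; field.
- apply: continuous_subspaceT => x.
  have dG : is_derive x (1:R) (fun x : R => d + e * (x - s) ^+ 2) (e * (2 * (x - s))).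
    by apply: is_derive_eq; rewrite /GRing.scale /=; ring.
  by apply/differentiable_continuous/derivable1_diffP.
- split => //.
  + exact/cvg_at_right_filter/cF.
  + exact/cvg_at_left_filter/cF.
- by move=> x _; rewrite derive1E derive_val.
Qed.

Lemma integral_segment_split f a b c : a <= b -> b <= c ->
  measurable_fun [set: R] f -> (forall x, 0 <= f x)%E ->
  (\int[mu]_(x in `[a, c]) f x =
   \int[mu]_(x in `[a, b]) f x + \int[mu]_(x in `[b, c]) f x)%E.
Proof.
move=> ab bc mf f0.
rewrite (@itv_bndbnd_setU _ _ _ (BLeft b))//=.
rewrite ge0_integral_setU//=.
- by rewrite integral_itv_bndo_bndc//; exact: measurable_funTS.
- exact: measurable_funTS.
- apply/disj_setPRL => x /=; rewrite !in_itv/= => /andP[bx _].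
  by apply/negP; rewrite negb_and -!leNgt bx orbT.
Qed.

Lemma integral_segment_steps f (u : nat -> R) n :
  {homo u : i j / (i <= j)%N >-> i <= j} ->
  measurable_fun [set: R] f -> (forall x, 0 <= f x)%E ->
  (\int[mu]_(x in `[u 0%N, u n]) f x =
   \sum_(i < n) \int[mu]_(x in `[u i, u i.+1]) f x)%E.
Proof.
move=> hu mf f0; elim: n => [|n IHn].
  by rewrite big_ord0 set_itv1 integral_set1.
by rewrite (@integral_segment_split _ _ (u n)) ?hu// IHn big_ord_recr.
Qed.

(** The most that a point at [s] can lower the squared distance at [x] below the level [w ^+ 2]: a
    bump supported on [[s - w, s + w]]. *)
Definition cap w s (x : R) : R := Num.max 0 (w ^+ 2 - (x - s) ^+ 2).

Lemma cap_ge0 w s x : 0 <= cap w s x.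
Proof. by rewrite /cap le_max lexx. Qed.

Lemma measurable_cap w s : measurable_fun [set: R] (fun x => (cap w s x)%:E).
Proof.
apply/measurable_EFinP; apply: measurable_maxr => //.
apply: measurable_funB => //; apply: measurable_funX.
exact: measurable_funB.
Qed.

(** Half of the bump has area [w^3 - w^3 / 3], and no choice of [B] can capture more. *)
Lemma integral_cap_right w s (B : R) : 0 <= w ->
  (\int[mu]_(x in `[s, (s + B)%R]) (cap w s x)%:E <= (2 / 3 * w ^+ 3)%:E)%E.
Proof.
(* Enlarging the segment to a length of at least [w] allows the cut at [s + w], beyond which the
   bump vanishes. *)
move=> w0; pose C := Num.max w B.
have b0 x : (0 <= (cap w s x)%:E)%E by rewrite lee_fin cap_ge0.
apply: (@le_trans _ _ (\int[mu]_(x in `[s, (s + C)%R]) (cap w s x)%:E)%E).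
  apply: ge0_subset_integral => //.
    exact: measurable_funTS (measurable_cap _ _).
  by apply: subset_itvl; rewrite bnd_simp lerD2l /C le_max lexx orbT.
rewrite (@integral_segment_split _ _ (s + w)) ?lerDl ?lerD2l ?le_max ?lexx//;
  last exact: measurable_cap.
rewrite [X in (_ + X)%E]integral0_eq; last first.
  move=> x; rewrite /= in_itv/= => /andP[sx _]; congr EFin.
  by apply/max_idPl; nra.
rewrite adde0.
have -> : (\int[mu]_(x in `[s, (s + w)%R]) (cap w s x)%:E
    = \int[mu]_(x in `[s, (s + w)%R]) (w ^+ 2 + (-1) * (x - s) ^+ 2)%:E)%E.
  apply: eq_integral => x; rewrite inE/= in_itv/= => /andP[sx xw]; congr EFin.
  rewrite /cap mulN1r; apply/max_idPr; nra.
rewrite integral_quadratic ?lerDl// lee_fin.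
by rewrite le_eqVlt; apply/orP; left; apply/eqP; field.
Qed.

Lemma integral_cap_left w s (B : R) : 0 <= w ->
  (\int[mu]_(x in `[(s - B)%R, s]) (cap w s x)%:E <= (2 / 3 * w ^+ 3)%:E)%E.
Proof.
move=> w0; pose C := Num.max w B.
have b0 x : (0 <= (cap w s x)%:E)%E by rewrite lee_fin cap_ge0.
apply: (@le_trans _ _ (\int[mu]_(x in `[(s - C)%R, s]) (cap w s x)%:E)%E).
  apply: ge0_subset_integral => //.
    exact: measurable_funTS (measurable_cap _ _).
  by apply: subset_itvr; rewrite bnd_simp lerB// /C le_max lexx orbT.
rewrite (@integral_segment_split _ _ (s - w)) ?gerBl ?lerB ?le_max ?lexx//;
  last exact: measurable_cap.
rewrite [X in (X + _)%E]integral0_eq; last first.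
  move=> x; rewrite /= in_itv/= => /andP[_ sx]; congr EFin.
  by apply/max_idPl; nra.
rewrite add0e.
have -> : (\int[mu]_(x in `[(s - w)%R, s]) (cap w s x)%:E
    = \int[mu]_(x in `[(s - w)%R, s]) (w ^+ 2 + (-1) * (x - s) ^+ 2)%:E)%E.
  apply: eq_integral => x; rewrite inE/= in_itv/= => /andP[sx xw]; congr EFin.
  rewrite /cap mulN1r; apply/max_idPr; nra.
rewrite integral_quadratic ?gerBl// lee_fin.
by rewrite le_eqVlt; apply/orP; left; apply/eqP; field.
Qed.

(** Bounds the number of halves of the bump around [s] that [[a, b]] can capture: at or beyond an
    end, only one side of [s] faces the segment. *)
Definition weight a b s : nat := if (a < s < b) then 2%N else 1%N.

Lemma integral_cap w s a b : 0 <= w -> a <= b ->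
  (\int[mu]_(x in `[a, b]) (cap w s x)%:E
     <= ((weight a b s)%:R * (2 / 3 * w ^+ 3))%:E)%E.
Proof.
move=> w0 ab.
have b0 x : (0 <= (cap w s x)%:E)%E by rewrite lee_fin cap_ge0.
have mb := measurable_cap w s.
rewrite /weight; case: (ltP a s) => [las|sa] /=; last first.
  rewrite mul1r; apply: le_trans (integral_cap_right s (b - s) w0).
  rewrite subrKC.
  apply: ge0_subset_integral => //; first exact: measurable_funTS.
  by apply: subset_itvr; rewrite bnd_simp.
case: (ltP s b) => [sb|bs] /=; last first.
  rewrite mul1r; apply: le_trans (integral_cap_left s (s - a) w0).
  rewrite subKr.
  apply: ge0_subset_integral => //; first exact: measurable_funTS.
  by apply: subset_itvl; rewrite bnd_simp.
rewrite (integral_segment_split (ltW las) (ltW sb))//.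
have := integral_cap_left s (s - a) w0; have := integral_cap_right s (b - s) w0.
rewrite subKr subrKC => h1 h2.
rewrite mulr_natl mulr2n EFinD; exact: leeD.
Qed.

Implicit Types S T : {fset R}.

Lemma mindist_ge0 S x : (0 <= mindist S x)%E.
Proof.
rewrite /mindist; elim/big_ind: _ => //= [u v u0 v0|a _].
  by rewrite le_min u0.
by rewrite lee_fin sqr_ge0.
Qed.

Lemma mindist_le S a x : a \in S -> (mindist S x <= ((x - a) ^+ 2)%:E)%E.
Proof. by move=> aS; rewrite /mindist (big_rem a)//= ge_min lexx. Qed.

Lemma le_mindist S x (v : \bar R) :
  (forall a, a \in S -> (v <= ((x - a) ^+ 2)%:E)%E) -> (v <= mindist S x)%E.
Proof.
move=> h; rewrite /mindist big_seq; elim/big_ind: _ => //= [|u w hu hw].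
  by rewrite leey.
by rewrite le_min hu.
Qed.

Lemma measurable_mindist S : measurable_fun [set: R] (mindist S).
Proof.
rewrite /mindist; elim: (enum_fset S) => [|a s IHs].
  under eq_fun do rewrite big_nil.
  exact: measurable_cst.
under eq_fun do rewrite big_cons.
apply: measurable_mine => //; apply/measurable_EFinP/measurable_funX.
exact: measurable_funB.
Qed.

(** For each [s], the bump of its substitute [t] alone makes up for [w^2 - (x - s)^2], and the other
    bumps are nonnegative. [T] will hold the points that compete on one cell. *)
Lemma mindist_cap S (T : seq R) w x :
  (forall s, s \in S -> exists2 t, t \in T & (x - t) ^+ 2 <= (x - s) ^+ 2) ->
  ((w ^+ 2)%:E <= mindist S x + \sum_(t <- T) (cap w t x)%:E)%E.
Proof.
move=> hST; rewrite sumEFin -leeBlDr// -EFinB.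
apply: le_mindist => s /hST[t tT ts]; rewrite lee_fin.
apply: le_trans ts; rewrite (big_rem t)//= lerBlDr.
have h1 : 0 <= \sum_(u <- rem t T) cap w u x by apply: sumr_ge0 => u _; exact: cap_ge0.
have h2 : w ^+ 2 - (x - t) ^+ 2 <= cap w t x by rewrite /cap le_max lexx orbT.
lra.
Qed.
End SegmentIntegral.

(** * Lower and upper bounds for the error on one segment *)

Section SegmentBounds.
Variable R : realType.
Local Notation mu := (@lebesgue_measure R).
Implicit Types (S : {fset R}) (T : seq R) (a b : R) (p : nat).

(** Integrating [mindist_cap] bounds the error below by [w^2 (b - a) - p (2/3) w^3]. The choice
    [w = (b - a) / p] maximizes this and gives [p w^3 / 3]. *)
Lemma segment_error_ge S T a b p : a <= b -> (0 < p)%N ->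
  (\sum_(t <- T) weight a b t <= p)%N ->
  (forall x, a <= x <= b ->
    forall s, s \in S -> exists2 t, t \in T & (x - t) ^+ 2 <= (x - s) ^+ 2) ->
  (((b - a) ^+ 3 / 3 / p%:R ^+ 2)%:E <= \int[mu]_(x in `[a, b]) mindist S x)%E.
Proof.
move=> ab p0 Tp hST; pose w := (b - a) / p%:R.
have pR : 0 < p%:R :> R by rewrite ltr0n.
have w0 : 0 <= w by rewrite divr_ge0 ?subr_ge0// ltW.
have ms := measurable_funTS (measurable_mindist S).
have mb t := measurable_funTS (measurable_cap w t).
have mT : measurable_fun `[a, b] (fun x => \sum_(t <- T) (cap w t x)%:E)%E.
  by apply: (@emeasurable_sum _ _ _ _ _ _ (fun t x => (cap w t x)%:E)) => t; exact: mb.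
have I1 : ((w ^+ 2 * (b - a))%:E <= \int[mu]_(x in `[a, b])
    (mindist S x + \sum_(t <- T) (cap w t x)%:E))%E.
  have := integral_quadratic (w ^+ 2) 0 0 ab; rewrite mul0r addr0 => <-.
  apply: ge0_le_integral => //.
  - by move=> x _; rewrite lee_fin mul0r addr0 sqr_ge0.
  - exact: measurable_quadratic.
  - exact: (emeasurable_funD (ms _) mT).
  - move=> x; rewrite /= in_itv/= => xab; rewrite mul0r addr0.
    by apply: mindist_cap; exact: hST.
move: I1; rewrite ge0_integralD//=; last 3 first.
- by move=> x _; exact: mindist_ge0.
- exact: ms.
- by move=> x _; rewrite sume_ge0// => t _; rewrite lee_fin cap_ge0.
rewrite ge0_integral_sum//=; last 2 first.
- by move=> t; exact: mb.
- by move=> t x _; rewrite lee_fin cap_ge0.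
move=> I1.
have I2 : (\sum_(t <- T) \int[mu]_(x in `[a, b]) (cap w t x)%:E <=
    (p%:R * (2 / 3 * w ^+ 3))%:E)%E.
  apply: (@le_trans _ _ (\sum_(t <- T) ((weight a b t)%:R * (2 / 3 * w ^+ 3))%:E)%E).
    by apply: lee_sum => t _; exact: integral_cap.
  rewrite sumEFin lee_fin -mulr_suml -natr_sum ler_wpM2r ?ler_nat//.
  by rewrite mulr_ge0// exprn_ge0.
have := le_trans I1 (leeD (lexx _) I2).
rewrite -leeBlDr// -EFinB; congr (_ <= _)%E; congr EFin.
by rewrite /w; field; rewrite pnatr_eq0 -lt0n.
Qed.

(** Among the nodes cutting [[a, b]] into [p] equal pieces, those whose index has the parity of [p]
    lie in [S]. Hence each piece has an end in [S] and costs at most [w^3 / 3]. The right end always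
    belongs to these nodes, the left end only for even [p]. *)
Lemma segment_error_le S a b p : a <= b -> (0 < p)%N ->
  (forall i, (i <= p)%N -> ~~ odd (p - i) ->
    a + i%:R * ((b - a) / p%:R) \in S) ->
  (\int[mu]_(x in `[a, b]) mindist S x <= ((b - a) ^+ 3 / 3 / p%:R ^+ 2)%:E)%E.
Proof.
move=> ab p0 hS; pose w := (b - a) / p%:R.
have pR : 0 < p%:R :> R by rewrite ltr0n.
have w0 : 0 <= w by rewrite divr_ge0 ?subr_ge0// ltW.
pose u (i : nat) : R := a + i%:R * w.
have ua : u 0%N = a by rewrite /u mul0r addr0.
have ub : u p = b by rewrite /u /w; field; rewrite pnatr_eq0 -lt0n.
have uS i : u i.+1 = u i + w by rewrite /u -natr1; ring.
have hu : {homo u : i j / (i <= j)%N >-> i <= j}.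
  by move=> i j ij; rewrite lerD2l ler_wpM2r ?ler_nat.
have ms : measurable_fun [set: R] (mindist S) by exact: measurable_mindist.
have s0 x : (0 <= mindist S x)%E by exact: mindist_ge0.
rewrite -[X in `[X, _]]ua -[X in `[_, X]]ub integral_segment_steps//.
have cell (i : 'I_p) :
    (\int[mu]_(x in `[u i, u i.+1]) mindist S x <= (w ^+ 3 / 3)%:E)%E.
  have [s sS sE] : exists2 s, s \in S & s = u i \/ s = u i.+1.
    have [od|ev] := boolP (odd (p - i)); last first.
      by exists (u i); [apply: hS => //; exact: ltnW|left].
    exists (u i.+1); last by right.
    by apply: hS => //; have := ltn_ord i; lia.
  apply: (@le_trans _ _ (\int[mu]_(x in `[u i, u i.+1])
      (0 + 1 * (x - s) ^+ 2)%:E)%E).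
    apply: ge0_le_integral => //.
    - exact: measurable_funTS.
    - exact: measurable_quadratic.
    - by move=> x _; rewrite add0r mul1r; exact: mindist_le.
  rewrite integral_quadratic ?hu// lee_fin uS.
  by case: sE => ->; rewrite ?uS le_eqVlt; apply/orP; left; apply/eqP; field.
apply: le_trans (lee_sum _ (fun i _ => cell i)) _.
rewrite sumEFin lee_fin big_const_ord iter_addr_0 -mulr_natr.
rewrite le_eqVlt; apply/orP; left; apply/eqP.
by rewrite /w; field; rewrite pnatr_eq0 -lt0n.
Qed.
End SegmentBounds.

(** * The grid, its cells and the total error *)

Section Grid.
Variable R : realType.
Variable k : nat.
Hypothesis k0 : (0 < k)%N.
Local Notation mu := (@lebesgue_measure R).
Implicit Types (S : {fset R}) (c p : nat -> nat) (i j : nat) (x : R).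

Definition grid j : R := j%:R / k%:R.

Lemma natk_gt0 : 0 < k%:R :> R. Proof. by rewrite ltr0n. Qed.

Lemma ler_grid i j : (grid i <= grid j) = (i <= j)%N.
Proof. by rewrite ler_pM2r ?invr_gt0 ?natk_gt0// ler_nat. Qed.

Lemma ltr_grid i j : (grid i < grid j) = (i < j)%N.
Proof. by rewrite ltr_pM2r ?invr_gt0 ?natk_gt0// ltr_nat. Qed.

Lemma grid0 : grid 0%N = 0. Proof. by rewrite /grid mul0r. Qed.

Lemma gridS j : grid j.+1 = grid j + k%:R^-1.
Proof. by rewrite /grid -natr1 mulrDl mul1r. Qed.

Lemma mem_beta_k x :
  reflect (exists2 j, (0 < j <= k)%N & x = grid j) (x \in beta_k R k).
Proof.
apply: (iffP (imfsetP _ _ _ _)) => /= -[j jk ->]; exists j => //.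
  by move: jk; rewrite mem_iota; lia.
by rewrite mem_iota; lia.
Qed.

Lemma grid_beta_k j : (0 < j <= k)%N -> grid j \in beta_k R k.
Proof. by move=> jk; apply/mem_beta_k; exists j. Qed.

Lemma card_beta_k : #|` beta_k R k| = k.
Proof.
rewrite card_imfset /=; last first.
  move=> i j /eqP; rewrite eq_le -!/(grid _) !ler_grid => /andP[ij ji].
  by apply/eqP; rewrite eqn_leq ij.
by rewrite undup_id ?iota_uniq// size_iota.
Qed.

Lemma qerr_segments S :
  (qerr (unif01 R) S = \sum_(j < k) \int[mu]_(x in `[grid j, grid j.+1]) mindist S x)%E.
Proof.
have ms : measurable_fun [set: R] (mindist S) by exact: measurable_mindist.
have s0 x : (0 <= mindist S x)%E by exact: mindist_ge0.
rewrite /qerr /unif01 integral_uniform// subr0 invr1 mul1e.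
have g1 : grid k = 1 by rewrite /grid divff// gt_eqF// natk_gt0.
rewrite -[X in `[X, _]]grid0 -[X in `[_, X]]g1 integral_segment_steps//.
by move=> i j ij; rewrite ler_grid.
Qed.

(* The only point of [beta_k] in the first cell is its right end, so that cell
   is left open towards minus infinity: the points to its left serve it too. *)
Definition inner j x := ((j == 0%N) || (grid j < x)) && (x < grid j.+1).

Definition ninner S j := count (inner j) S.

(* With [n] equidistant inner points a cell is cut into this many equal
   pieces, each having one end in the set and lying in the Voronoi region of
   that end. *)
Definition pieces j n := if j == 0%N then n.*2.+1 else n.*2.+2.

Definition pieces_err p : R := \sum_(j < k) (k%:R^-1 ^+ 3 / 3 / (p j)%:R ^+ 2).

Lemma pieces_gt0 j n : (0 < pieces j n)%N.
Proof. by rewrite /pieces; case: ifP. Qed.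

Lemma inner_inj i j x : inner i x -> inner j x -> i = j.
Proof.
wlog ij : i j / (i < j)%N => [H|] hi hj.
  have [||//] := ltngtP i j; first by move=> ij; exact: H.
  by move=> ij; apply/esym; exact: H.
move: hi hj => /andP[_ xi] /andP[+ _]; rewrite gtn_eqF ?(leq_ltn_trans _ ij)//= => jx.
by have := lt_trans jx xi; rewrite ltr_grid ltnS leqNgt ij.
Qed.

Lemma inner_beta_k j x : inner j x -> x \notin beta_k R k.
Proof.
move=> /andP[jx xj]; apply/negP => /mem_beta_k[i /andP[i0 _] xE].
move: jx xj; rewrite {}xE !ltr_grid ltnS => /orP[/eqP->|]; lia.
Qed.

(** Double counting: a grid point is inner to no cell and any other point to at most one. Points
    beyond 1 are inner to none, hence only an inequality. *)
Lemma sum_ninner S :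
  (\sum_(j < k) ninner S j <= count (fun x => x \notin beta_k R k) S)%N.
Proof.
rewrite -sum1_count [leqRHS]big_mkcond /=.
under eq_bigr do rewrite /ninner -sum1_count big_mkcond /=.
rewrite exchange_big /=; apply: leq_sum => x _.
have [xb|_] := boolP (x \in beta_k R k).
  by rewrite big1// => j _; case: ifP => // /inner_beta_k; rewrite xb.
rewrite -big_mkcond sum1_card /=.
by apply/card_le1_eqP => i j hi hj; apply/val_inj; exact: (inner_inj hj hi).
Qed.

Definition in_cell j x := ((j == 0%N) || (grid j <= x)) && (x <= grid j.+1).

(* A point at or below 0 has weight 1 instead of 2 in the first cell; the count
   of such points makes the error bound strict when there are any. *)
Lemma weight_sum S j :
  (\sum_(t <- S | in_cell j t) weight (grid j) (grid j.+1) t +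
   (j == 0) * count (fun x : R => (x <= 0)%R) S <= pieces j (ninner S j))%N.
Proof.
have countE (P : pred R) : (\sum_(t <- S) P t)%N = count P S.
  by rewrite -sum1_count [RHS]big_mkcond; apply: eq_bigr => t _; case: P.
have Ueq a : (\sum_(t <- S) (t == a) <= 1)%N.
  by rewrite (countE (pred1 a)) count_uniq_mem ?fset_uniq//; case: (_ \in _).
have -> : pieces j (ninner S j) = (ninner S j * 2 + 1 + (j != 0%N))%N.
  by rewrite /pieces; case: eqP => _ /=; lia.
(* Compared point by point: an inner point is allotted 2 and a grid end 1. In the first cell a point
   at or below 0 weighs only 1, and its spare unit pays for the extra count. *)
have H : (\sum_(t <- S | in_cell j t) weight (grid j) (grid j.+1) t +
   (j == 0) * count (fun x : R => (x <= 0)%R) S <=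
   \sum_(t <- S) (inner j t * 2 + (t == grid j.+1) + (j != 0%N) * (t == grid j)))%N.
  rewrite -countE big_distrr /= big_mkcond -big_split /=.
  apply: leq_sum => t _; rewrite /in_cell /inner /weight.
  have jj : grid j < grid j.+1 by rewrite ltr_grid.
  case: (j =P 0%N) => [->|_] /=.
    have : grid 0%N < grid 1%N by rewrite ltr_grid.
    rewrite grid0 => h0.
    case: (ltrgtP t (grid 1%N)) => t1; case: (ltrgtP t 0) => t0 //=; (lra || lia).
  by case: (ltrgtP t (grid j.+1)) => t1; case: (ltrgtP t (grid j)) => t0 //=; (lra || lia).
apply: leq_trans H _; rewrite !big_split /= -big_distrl -big_distrr /=.
rewrite countE -/(ninner S j).
move: (Ueq (grid j.+1)) (Ueq (grid j)) => U1 U0.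
by rewrite leq_add ?leq_add2l// -[leqRHS]muln1 leq_mul2l U0 orbT.
Qed.

(** The bound [p] is left free because it is used both with [pieces] and with one less in the first
    cell. *)
Lemma qerr_ge S p : {subset beta_k R k <= S} ->
  (forall j, (j < k)%N -> (0 < p j)%N) ->
  (forall j, (j < k)%N ->
    (\sum_(t <- S | in_cell j t) weight (grid j) (grid j.+1) t <= p j)%N) ->
  ((pieces_err p)%:E <= qerr (unif01 R) S)%E.
Proof.
move=> bS p0 pT; rewrite qerr_segments -sumEFin; apply: lee_sum => j _.
have jk := ltn_ord j.
have gj : grid j.+1 - grid j = k%:R^-1 by rewrite gridS addrAC subrr add0r.
rewrite -gj; apply: (@segment_error_ge _ _ [seq t <- S | in_cell j t]).
- by rewrite ler_grid.
- exact: p0.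
- by rewrite big_filter; exact: pT.
move=> x /andP[jx xj] s sS.
have bS1 : grid j.+1 \in S by apply/bS/grid_beta_k.
(* A point outside the cell is beaten by the end of the cell on its side. A point is left of the
   cell only when [j] is positive, and then [grid j] is in [beta_k]. *)
have [sj|js] := leP s (grid j.+1); last first.
  exists (grid j.+1); last by nra.
  by rewrite mem_filter bS1 /in_cell lexx ler_grid leqnSn orbT.
have [ns|] := boolP (in_cell j s).
  by exists s; rewrite // mem_filter ns.
rewrite /in_cell sj andbT negb_or -ltNge => /andP[j0 sj0].
have bS0 : grid j \in S by apply/bS/grid_beta_k; rewrite lt0n j0 ltnW.
exists (grid j); last by nra.
by rewrite mem_filter bS0 /in_cell lexx ler_grid leqnSn orbT.
Qed.

Lemma qerr_ge_pieces S : {subset beta_k R k <= S} ->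
  ((pieces_err (fun j => pieces j (ninner S j)))%:E <= qerr (unif01 R) S)%E.
Proof.
move=> bS; apply: qerr_ge => // j jk; first exact: pieces_gt0.
by apply: leq_trans (weight_sum S j); exact: leq_addr.
Qed.

(** Such a point is inner to the first cell but has weight 1, so the lower bound holds with one
    piece less there and is strictly larger. *)
Lemma qerr_gt_pieces S s : {subset beta_k R k <= S} -> s \in S -> s <= 0 ->
  ((pieces_err (fun j => pieces j (ninner S j)))%:E < qerr (unif01 R) S)%E.
Proof.
move=> bS sS s0.
pose p j := (pieces j (ninner S j) - (j == 0%N))%N.
(* Since [s] itself is inner to the first cell, [p 0] stays positive after the subtraction. *)
have n0 : (0 < ninner S 0%N)%N.
  rewrite -has_count; apply/hasP; exists s => //.
  by rewrite /inner eqxx/= (le_lt_trans s0)// -[ltLHS]grid0 ltr_grid.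
have c0 : (0 < count (fun x : R => (x <= 0)%R) S)%N.
  by rewrite -has_count; apply/hasP; exists s.
have p0 j : (0 < p j)%N by rewrite /p /pieces; case: eqP => [->|]; lia.
apply: lt_le_trans (qerr_ge (p := p) bS _ _) => //; last first.
  move=> j _; have := weight_sum S j.
  by rewrite /p; case: eqP => [->|_]; rewrite ?mul1n ?mul0n; lia.
have h0 : 0 < k%:R^-1 ^+ 3 / 3 :> R by rewrite divr_gt0// exprn_gt0// invr_gt0 natk_gt0.
rewrite lte_fin /pieces_err !(bigD1 (Ordinal k0) (P := xpredT))//=; apply: ltr_leD.
  rewrite ltr_pM2l// ltf_pV2 ?posrE ?exprn_gt0 ?ltr0n ?pieces_gt0//.
  rewrite ltr_pXn2r ?nnegrE ?ler0n// ltr_nat /p /=.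
  by have := pieces_gt0 0%N (ninner S 0%N); lia.
apply: ler_sum => j; rewrite -val_eqE /= => /negPf j0.
by rewrite /p j0 subn0.
Qed.

Lemma exists_alpha c : exists2 alpha : {fset R},
  (#|` alpha| <= \sum_(j < k) c j)%N &
  (qerr (unif01 R) (alpha `|` beta_k R k)%fset <= (pieces_err (fun j => pieces j (c j)))%:E)%E.
Proof.
pose h j : R := (grid j.+1 - grid j) / (pieces j (c j))%:R.
(* The nodes at even multiples of [h j] from the right end, which is itself a grid point. *)
pose s := flatten [seq [seq grid j.+1 - i.*2%:R * h j | i <- iota 1 (c j)] | j <- iota 0 k].
exists [fset x in s]%fset.
  rewrite card_fseq (leq_trans (size_undup _))// size_flatten /shape -map_comp.
  rewrite sumnE big_map -(big_mkord xpredT) /index_iota subn0 leq_sum// => j _.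
  by rewrite /= size_map size_iota.
rewrite qerr_segments -sumEFin; apply: lee_sum => j _.
have jk := ltn_ord j.
have gj : grid j.+1 - grid j = k%:R^-1 by rewrite gridS addrAC subrr add0r.
rewrite -gj; apply: segment_error_le.
- by rewrite ler_grid.
- exact: pieces_gt0.
move=> i ip ev; rewrite -/(h j) in_fsetU; apply/orP.
have pR : (pieces j (c j))%:R != 0 :> R by rewrite pnatr_eq0 -lt0n pieces_gt0.
have -> : grid j + i%:R * h j = grid j.+1 - ((pieces j (c j) - i)./2.*2)%:R * h j.
  rewrite (_ : ((pieces j (c j) - i)./2.*2 = pieces j (c j) - i)%N); last lia.
  by rewrite natrB// /h; field.
(* Counted from the right, node [t = 0] is the right end and nodes 1 to [c j] are the new points. A
   larger [t] occurs only for the left end of a cell other than the first. *)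
set t := ((pieces j (c j) - i)./2)%N.
have [t0|t0] := posnP t.
  by right; rewrite t0 mul0r subr0 grid_beta_k.
have [tc|tc] := leqP t (c j).
  left; rewrite inE; apply/flatten_mapP; exists (j : nat).
    by rewrite mem_iota.
  by apply/mapP; exists t; rewrite // mem_iota; lia.
right; have [j0 tp] : (0 < j)%N /\ (t.*2 = pieces j (c j))%N.
  move: tc; rewrite /t /pieces; case: eqP; lia.
by rewrite tp /h mulrC divfK// subKr grid_beta_k// j0 ltnW.
Qed.
End Grid.

(** The gap factors as [2 z^-1 (z + 2)^-1 (z^-1 + (z + 2)^-1)], a product of positive factors, all
    decreasing in [z] except the constant. *)
Lemma inv_sqr_gap (R : realFieldType) (x y : R) : 0 < x -> x < y ->
  (y ^+ 2)^-1 - ((y + 2) ^+ 2)^-1 < (x ^+ 2)^-1 - ((x + 2) ^+ 2)^-1.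
Proof.
move=> x0 xy.
have factor (z : R) : 0 < z -> (z ^+ 2)^-1 - ((z + 2) ^+ 2)^-1 =
    2 * (z^-1 * (z + 2)^-1 * (z^-1 + (z + 2)^-1)).
  by move=> z0; field; rewrite !gt_eqF ?addr_gt0.
have y0 := lt_trans x0 xy.
rewrite !factor// ltr_pM2l//.
have h1 : y^-1 < x^-1 by rewrite ltf_pV2.
have h2 : (y + 2)^-1 < (x + 2)^-1 by rewrite ltf_pV2 ?posrE ?addr_gt0// ltrD2r.
have h3 : 0 < y^-1 by rewrite invr_gt0.
have h4 : 0 < (y + 2)^-1 by rewrite invr_gt0 addr_gt0.
by rewrite ltr_pM ?ltrD ?mulr_ge0 ?addr_ge0 ?ltr_pM// ltW.
Qed.

(** * Balanced distributions of points over the cells *)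

Section Balance.
Variable R : realType.
Variable k : nat.
Hypothesis k0 : (0 < k)%N.
Implicit Types (c n : nat -> nat).

Lemma ltr_invsqr (p q : nat) : (0 < p < q)%N ->
  (q%:R ^+ 2)^-1 < (p%:R ^+ 2)^-1 :> R.
Proof.
move=> /andP[p0 pq]; have q0 := ltn_trans p0 pq.
by rewrite ltf_pV2 ?posrE ?exprn_gt0 ?ltr0n// ltr_pXn2r ?nnegrE ?ler0n// ltr_nat.
Qed.

Lemma optimal_balanced N n : (\sum_(j < k) n j <= N)%N ->
  (forall c, (\sum_(j < k) c j <= N)%N ->
    pieces_err R k (fun j => pieces j (n j)) <= pieces_err R k (fun j => pieces j (c j))) ->
  (\sum_(j < k) n j = N)%N /\
  (forall i j, (i < k)%N -> (j < k)%N ->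
    (pieces i (n i) <= pieces j (n j) + 2)%N).
Proof.
move=> nN nopt.
have h0 : 0 < k%:R^-1 ^+ 3 / 3 :> R.
  by rewrite divr_gt0// exprn_gt0// invr_gt0 ltr0n.
split.
  (* An unspent point, put into the first cell, would lower the error. *)
  apply/eqP; rewrite eqn_leq nN /= leqNgt; apply/negP => ltN.
  pose c j := (n j + (j == 0))%N.
  have sc : (\sum_(j < k) c j = (\sum_(j < k) n j).+1)%N.
    rewrite big_split /= -[RHS]addn1; congr addn.
    by rewrite (bigD1 (Ordinal k0))//= big1// => j; rewrite -val_eqE /= => /negPf->.
  have := nopt c; rewrite sc => /(_ ltN); apply/negP; rewrite -ltNge.
  rewrite /pieces_err !(bigD1 (Ordinal k0) (P := xpredT))//=; apply: ltr_leD.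
    rewrite ltr_pM2l// ltr_invsqr// pieces_gt0 /c /pieces /=; lia.
  by apply: ler_sum => j; rewrite -val_eqE /= /c => /negPf ->; rewrite addn0.
(* Otherwise moving a point from cell [i] to cell [j] gains the gap at [pieces j (n j)] and loses
   the smaller gap at [pieces i (n i) - 2]. *)
move=> i j ik jk; rewrite leqNgt; apply/negP => lt_ji.
have ij : i != j by apply: contraTneq lt_ji => ->; lia.
have ni : (0 < n i)%N by move: lt_ji; rewrite /pieces; case: eqP; case: eqP; lia.
pose c x := (n x + (x == j) - (x == i))%N.
pose oi := Ordinal ik; pose oj := Ordinal jk.
have oij : oj != oi by rewrite -val_eqE /= eq_sym.
have cE x : x != i -> x != j -> c x = n x.
  by move=> /negPf xi /negPf xj; rewrite /c xi xj addn0 subn0.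
have ci : c i = (n i).-1 by rewrite /c eqxx (negPf ij) addn0 subn1.
have cj : c j = (n j).+1 by rewrite /c eqxx eq_sym (negPf ij) addn1 subn0.
have rest (x : 'I_k) : (x != oi) && (x != oj) -> c x = n x.
  by rewrite -!val_eqE => /andP[]; exact: cE.
have sc : (\sum_(j < k) c j = \sum_(j < k) n j)%N.
  rewrite !(bigD1 oi (P := xpredT))//= !(bigD1 oj (P := fun x => x != oi))//= ci cj.
  by rewrite (eq_bigr _ rest) !addnA addnS -addSn prednK.
have := nopt c; rewrite sc => /(_ nN); apply/negP; rewrite -ltNge.
rewrite /pieces_err !(bigD1 oi (P := xpredT))//= !(bigD1 oj (P := fun x => x != oi))//= ci cj.
rewrite !addrA ltr_leD//; last first.
  by apply: ler_sum => x /rest ->.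
rewrite -!mulrDr ltr_pM2l//.
have pi : pieces i (n i) = (pieces i (n i).-1 + 2)%N.
  by rewrite /pieces; case: eqP; lia.
have pj : pieces j (n j).+1 = (pieces j (n j) + 2)%N.
  by rewrite /pieces; case: eqP; lia.
have lt_ji' : (pieces j (n j) < pieces i (n i).-1)%N by lia.
rewrite pj pi !natrD.
have := @inv_sqr_gap R (pieces j (n j))%:R (pieces i (n i).-1)%:R.
rewrite ltr0n pieces_gt0 ltr_nat => /(_ isT lt_ji'); lra.
Qed.

(** Comparing [2 n_j + 2] with [2 n_0 + 1] leaves only [n_j = n_0] or [n_j = n_0 - 1]. If [E] cells
    have [n_j = n_0], then [k n_0 + E = m k + l] with [1 <= E <= k], so [E = k] when [l = 0] and
    [E = l] otherwise. The first cell is one of the [E], which leaves [l - 1] others. *)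
Lemma balanced_counts n m l : (l < k)%N ->
  (\sum_(j < k) n j + k = m * k + l)%N ->
  (forall i j, (i < k)%N -> (j < k)%N ->
    (pieces i (n i) <= pieces j (n j) + 2)%N) ->
  [/\ forall j, (j < k)%N -> n j = n 0%N \/ (n j).+1 = n 0%N,
     l = 0%N -> (n 0%N).+1 = m /\ forall j, (j < k)%N -> (n j).+1 = m &
     (0 < l)%N -> n 0%N = m /\ (\sum_(1 <= j < k) (n j == n 0%N) = l.-1)%N].
Proof.
move=> lk Hsum bal.
have near0 j : (j < k)%N -> n j = n 0%N \/ (n j).+1 = n 0%N.
  have [->|j0] := posnP j; first by left.
  move=> jk; have := bal 0%N j k0 jk; have := bal j 0%N jk k0.
  by rewrite /pieces eqxx (gtn_eqF j0); lia.
pose E := (\sum_(j < k) (n j == n 0%N))%N.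
have EE : (k * n 0%N + E = m * k + l)%N.
  have kE : (k = \sum_(j < k) 1)%N by rewrite sum1_card card_ord.
  have knE : (k * n 0 = \sum_(j < k) n 0)%N by rewrite sum_nat_const card_ord.
  rewrite -Hsum knE [X in (_ = _ + X)%N]kE -!big_split /=.
  by apply: eq_bigr => j _; have := near0 j (ltn_ord j); case: eqP; lia.
have E1 : E = (1 + \sum_(1 <= j < k) (n j == n 0%N))%N.
  by rewrite /E -(big_mkord xpredT (fun j => nat_of_bool (n j == n 0%N))) big_ltn// eqxx.
have Ek : (E + \sum_(j < k) (n j != n 0%N) = k)%N.
  rewrite -big_split /= -[RHS](card_ord k) -sum1_card.
  by apply: eq_bigr => j _; case: eqP.
split=> // [l0|l0].
  have n0m : (n 0%N).+1 = m by nia.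
  split=> // j jk.
  have /eqP : (\sum_(j < k) (n j != n 0%N) = 0)%N by nia.
  rewrite sum_nat_eq0 => /forallP /(_ (Ordinal jk)) /=.
  by rewrite eqb0 negbK => /eqP ->.
have n0m : n 0%N = m by nia.
by split=> //; nia.
Qed.

(** * From inner points to counts in the closed cells *)

Lemma cardJE j (S : {fset R}) :
  cardJ k j S = count (fun x => grid R k j.-1 <= x <= grid R k j) S.
Proof. by rewrite /cardJ card_imfset //= size_filter. Qed.

(** Positivity puts all inner points of the left-open first cell into the closed one; the right end
    adds one. *)
Lemma cardJ_first (S : {fset R}) : {subset beta_k R k <= S} ->
  (forall x, x \in S -> 0 < x) -> cardJ k 1%N S = (ninner k S 0%N).+1.
Proof.
move=> bS S0; rewrite cardJE /= grid0 /ninner.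
have -> : count (fun x => 0 <= x <= grid R k 1%N) S =
    count (predU (inner k 0%N) (pred1 (grid R k 1%N))) S.
  apply: eq_in_count => x xS.
  by rewrite /= /inner /= (ltW (S0 x xS)) /= le_eqVlt orbC.
have := count_predUI (inner k 0%N) (pred1 (grid R k 1%N)) S.
rewrite count_uniq_mem ?fset_uniq// bS ?grid_beta_k//.
rewrite (@eq_count _ (predI _ _) pred0) ?count_pred0; first by lia.
by move=> x /=; rewrite /inner /=; case: ltgtP.
Qed.

(** Both ends are grid points and add two; cells are numbered from 0 here and from 1 in [cardJ]. *)
Lemma cardJ_inner j (S : {fset R}) : (0 < j < k)%N -> {subset beta_k R k <= S} ->
  cardJ k j.+1 S = (ninner k S j).+2.
Proof.
move=> /andP[j0 jk] bS; rewrite cardJE /= /ninner.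
have jj : grid R k j < grid R k j.+1 by rewrite ltr_grid.
rewrite (@eq_count _ _ (predU (predU (inner k j) (pred1 (grid R k j)))
  (pred1 (grid R k j.+1)))); last first.
  move=> x /=; rewrite /inner (gtn_eqF j0) /=.
  by case: (ltrgtP x (grid R k j)); case: (ltrgtP x (grid R k j.+1)) => //=; lra.
have := count_predUI (predU (inner k j) (pred1 (grid R k j))) (pred1 (grid R k j.+1)) S.
have := count_predUI (inner k j) (pred1 (grid R k j)) S.
rewrite !count_uniq_mem ?fset_uniq// !bS ?grid_beta_k//; try lia.
rewrite (@eq_count _ (predI (inner _ _) _) pred0) ?count_pred0; last first.
  move=> x /=; rewrite /inner (gtn_eqF j0) /=.
  by case: eqP => [->|_]; rewrite ?andbF// ltxx.
rewrite (@eq_count _ (predI (predU _ _) _) pred0) ?count_pred0; last first.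
  move=> x /=; rewrite /inner (gtn_eqF j0) /=.
  by case: (x =P grid R k j.+1) => [->|_]; rewrite ?andbF// ltxx jj /= gt_eqF.
by lia.
Qed.
End Balance.
End Quantization.

Theorem theorem4p4 (R : realType) (k n m l : nat) (alpha_n : {fset R}) :
  (1 <= k)%N -> (k <= n)%N -> n = (m * k + l)%N -> (l < k)%N ->
  cond_optimal (unif01 R) (beta_k R k) n alpha_n ->
  (l = 0%N ->
     cardJ k 1 alpha_n = m /\
     (forall j, (2 <= j <= k)%N -> cardJ k j alpha_n = m.+1)) /\
  ((1 <= l)%N ->
     cardJ k 1 alpha_n = m.+1 /\
     exists S : {fset nat},
       [/\ #|` S| = l.-1, (forall j, j \in S -> (2 <= j <= k)%N) &
           forall j, (2 <= j <= k)%N ->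
             cardJ k j alpha_n = (if j \in S then m.+2 else m.+1)]).
Proof.
move=> k0 kn nE lk [alpha [alpha_le alphaE opt _]].
rewrite (card_beta_k R k0) in alpha_le.
pose c j := ninner k alpha_n j.
have bS : {subset beta_k R k <= alpha_n}.
  by move=> x xb; rewrite alphaE in_fsetU xb orbT.
have cN : (\sum_(j < k) c j <= n - k)%N.
  apply: leq_trans (sum_ninner k0 alpha_n) (leq_trans _ alpha_le).
  rewrite -size_filter; apply: uniq_leq_size; first exact/filter_uniq/fset_uniq.
  move=> x; rewrite mem_filter alphaE => /andP[xb].
  by rewrite in_fsetU (negPf xb) orbF.
have le_err (c' : nat -> nat) : (\sum_(j < k) c' j <= n - k)%N ->
    (qerr (unif01 R) alpha_n <= (pieces_err R k (fun j => pieces j (c' j)))%:E)%E.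
  move=> c'N; have [a ac aq] := exists_alpha R k0 c'.
  rewrite opt; apply: le_trans aq; apply: ereal_inf_lbound; exists a => //=.
  by rewrite (card_beta_k R k0) (leq_trans ac).
(* With a point at or below 0, the equidistant set with the same counts [c] would have a strictly
   smaller error. *)
have pos x : x \in alpha_n -> (0 < x)%R.
  move=> xa; rewrite ltNge; apply/negP => x0.
  have := lt_le_trans (qerr_gt_pieces k0 bS xa x0) (le_err _ cN).
  by rewrite ltxx.
(* The error of [alpha_n] lies between [pieces_err] for its own counts and [pieces_err] for any
   admissible [c'], so its counts are minimal. *)
have [sumc bal] := optimal_balanced k0 cN (fun c' h =>
  le_trans (qerr_ge_pieces k0 bS) (le_err c' h)).
have sumck : (\sum_(j < k) c j + k = m * k + l)%N by rewrite sumc subnK.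
have [near0 full part] := balanced_counts k0 lk sumck bal.
have J1 := cardJ_first k0 bS pos.
have J j : (2 <= j <= k)%N -> cardJ k j alpha_n = (c j.-1).+2.
  by case: j => // j jk; apply: cardJ_inner.
split=> [l0|l0].
  have [c0 cj] := full l0.
  split=> [|j jk]; first by rewrite J1.
  by rewrite J// cj//; lia.
have [c0 cnt] := part l0.
split; first by rewrite J1 -/(c 0%N) c0.
(* The later cells with as many inner points as the first one, namely [m]; their two ends bring the
   count to [m + 2]. *)
exists [fset j in iota 2 k.-1 | c j.-1 == c 0%N]%fset; split.
- rewrite card_imfset //= size_filter -cnt -sum1_count big_mkcond /=.
  have -> : iota 2 k.-1 = index_iota 2 k.+1 by rewrite /index_iota; congr iota; lia.
  rewrite undup_id ?iota_uniq// [LHS]big_add1 /=.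
  by apply: eq_bigr => j _; case: eqP.
- by move=> j; rewrite !inE /= mem_iota; lia.
- move=> j jk; rewrite J// !inE /= mem_iota -c0.
  have -> /= : (2 <= j < 2 + k.-1)%N by lia.
  have jk1 : (j.-1 < k)%N by lia.
  have [->|<-] := near0 _ jk1; first by rewrite eqxx.
  by case: eqP => //; lia.
Qed.
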